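(* Let $\mathbb{H}$ be a complex Hilbert space, let $A_1,\ldots,A_n\in B(\mathbb{H})$, and let $$T=\begin{pmatrix}0&0&\cdots&0&A_1\\ 0&0&\cdots&A_2&0\\ \vdots&\vdots& &\vdots&\vdots\\ A_n&0&\cdots&0&0\end{pmatrix}$$ be the $n\times n$ operator matrix on $\mathbb{H}\oplus\cdots\oplus\mathbb{H}$ ($n$ copies) whose $(i,n-i+1)$ entry is $A_i$ for $i=1,\ldots,n$ and whose other entries are zero. Then $$w(T)\geq\frac1{\sqrt2}\max_{1\leq i\leq n}\left\{\sqrt{w(A_iA_{n-i+1}+A_{n-i+1}A_i)},\ \sqrt{w(A_iA_{n-i+1}-A_{n-i+1}A_i)}\right\}.$$
   Context: $B(\mathbb{H})$ denotes the bounded linear operators on $\mathbb{H}$. For a bounded operator $S$ on a complex Hilbert space $\mathbb{K}$, the numerical radius is $w(S)=\sup\{|\langle Sx,x\rangle| : x\in\mathbb{K}, \|x\|=1\}$. The direct sum is the Hilbert space direct sum. *)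

(* Defs.v *)
From HB Require Import structures.
From mathcomp Require Import all_boot all_order all_algebra.
From mathcomp Require Import sesquilinear complex.
From mathcomp Require Import boolp classical_sets reals topology normedtype.
Set Implicit Arguments.
Unset Strict Implicit.
Unset Printing Implicit Defensive.
Import Order.TTheory GRing.Theory Num.Theory.
Import numFieldNormedType.Exports.
Local Open Scope classical_set_scope.
Local Open Scope ring_scope.
Local Open Scope complex_scope.

(* A complex Hilbert space is a complete normed module over R[i] whose norm is
   induced by an inner product, linear in its first argument. *)
HB.mixin Record NormedModule_hasInner (R : realType) H
    & NormedModule R[i] H := {
  inner : {dot H for @Num.conj R[i]};
  normr_inner : forall x : H, `|x| = sqrtC (inner x x)
}.

#[short(type="hilbertType")]
HB.structure Definition Hilbert (R : realType) :=
  {H of CompleteNormedModule R[i] H & NormedModule_hasInner R H}.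

Section DotNorm.
Variables (C : numClosedFieldType) (U : lmodType C).
Variable form : {dot U for @Num.conj C}.

Lemma dot_cauchy_schwarz (u v : U) :
  `|form u v| <= sqrtC (form u u) * sqrtC (form v v).
Proof.
have [->|v0] := eqVneq v 0.
  by rewrite linear0r normr0 mulr_ge0// sqrtC_ge0 dnorm_ge0.
have fv0 : 0 < form v v by rewrite dnorm_gt0.
rewrite -sqrtCM ?nnegrE ?dnorm_ge0// -(sqrCK (normr_ge0 _)).
rewrite ler_sqrtC ?nnegrE ?mulr_ge0 ?dnorm_ge0 ?exprn_ge0//.
pose a := form u v / form v v; pose w := u - a *: v.
have wv : form w v = 0.
  by rewrite linearBl linearZl_LR /= /a divfK ?gt_eqF// subrr.
have wav : form w (a *: v) = 0 by rewrite linearZr_LR /= wv mulr0.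
have -> : form u v = a * form v v by rewrite /a divfK ?gt_eqF.
have -> : form u u = form w w + `|a| ^+ 2 * form v v.
  by rewrite -dnormZ -hnormDd// subrK.
rewrite normrM (ger0_norm (ltW fv0)) exprMn expr2 mulrDl -!mulrA -expr2.
by rewrite lerDr mulr_ge0// dnorm_ge0.
Qed.

Lemma dot_normD (u v : U) : sqrtC (form (u + v) (u + v)) <=
  sqrtC (form u u) + sqrtC (form v v).
Proof.
have s0 w : 0 <= sqrtC (form w w) by rewrite sqrtC_ge0 dnorm_ge0.
rewrite -(@ler_pXn2r _ 2) ?nnegrE ?addr_ge0// sqrrD !sqrtCK dnormD.
rewrite [leRHS]addrAC lerD2l -mulr_natr.
have re := divfK (negbT (pnatr_eq0 C 2)) (form u v + (form u v)^*%R).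
rewrite -re -ReE ler_pM2r ?ltr0n//.
apply: le_trans (dot_cauchy_schwarz u v).
by have := leif_Re_Creal (form u v) => -[].
Qed.

End DotNorm.

(* The Hilbert space direct sum of n copies of H, with inner product
   \sum_i <x i, y i>; its norm and completeness are established below. *)
Definition dsum (n : nat) (H : Type) := {ffun 'I_n -> H}.

Section DirectSum.
Variables (R : realType) (n : nat) (H : hilbertType R).
Local Notation V := (dsum n H).

HB.instance Definition _ := GRing.Lmodule.copy V {ffun 'I_n -> H}.

Definition dsum_inner (x y : V) : R[i] := \sum_i inner (x i) (y i).

Lemma dsum_inner_bilinear : bilinear_for *%R (Num.conj \; *%R) dsum_inner.
Proof.
split=> [y a x x'|x a y y']; rewrite /dsum_inner.
  rewrite /= mulr_sumr -big_split; apply: eq_bigr => i _.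
  by rewrite !ffunE linearDl linearZl_LR.
rewrite /= mulr_sumr -big_split; apply: eq_bigr => i _.
by rewrite !ffunE linearDr linearZr_LR.
Qed.

HB.instance Definition _ := bilinear_isBilinear.Build R[i] V V R[i] _ _
  dsum_inner dsum_inner_bilinear.

Lemma dsum_inner_hermitian (x y : V) :
  dsum_inner x y = (-1) ^+ false * Num.conj (dsum_inner y x).
Proof.
rewrite mul1r rmorph_sum; apply: eq_bigr => i _.
by rewrite hermC mul1r.
Qed.

HB.instance Definition _ := isHermitianSesquilinear.Build R[i] V _ _
  dsum_inner dsum_inner_hermitian.

Lemma dsum_inner_gt0 (x : V) : x != 0 -> 0 < dsum_inner x x.
Proof.
move=> x0; rewrite lt_def sumr_ge0 ?andbT => [|i _]; last exact: dnorm_ge0.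
apply: contra x0 => /eqP/psumr_eq0P x0; apply/eqP/ffunP => i.
by rewrite ffunE; apply/eqP; rewrite -(dnorm_eq0 inner) x0.
Qed.

HB.instance Definition _ := isDotProduct.Build R[i] V dsum_inner dsum_inner_gt0.

Definition dsum_norm (x : V) : R[i] := sqrtC (dsum_inner x x).

Lemma dsum_normD (x y : V) : dsum_norm (x + y) <= dsum_norm x + dsum_norm y.
Proof. exact: dot_normD. Qed.

Lemma dsum_normZ (a : R[i]) (x : V) : dsum_norm (a *: x) = `|a| * dsum_norm x.
Proof.
by rewrite /dsum_norm dnormZ sqrtCM ?nnegrE ?exprn_ge0 ?dnorm_ge0// sqrCK.
Qed.

Lemma dsum_norm_eq0 (x : V) : dsum_norm x = 0 -> x = 0.
Proof. by move=> /eqP; rewrite sqrt_dnorm_eq0 => /eqP. Qed.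

HB.instance Definition _ :=
  Lmodule_isNormed.Build R[i] V dsum_normD dsum_normZ dsum_norm_eq0.

Lemma normr_dsum (x : V) : `|x| = sqrtC (\sum_i `|x i| ^+ 2).
Proof.
congr sqrtC; apply: eq_bigr => i _.
by rewrite normr_inner sqrtCK.
Qed.

Lemma dsum_norm_comp (x : V) i : `|x i| <= `|x|.
Proof.
rewrite -(@ler_pXn2r _ 2) ?nnegrE// normr_dsum sqrtCK (bigD1 i)//=.
by rewrite lerDl sumr_ge0// => j _; rewrite exprn_ge0.
Qed.

Lemma dsum_norm_le_sum (x : V) : `|x| <= \sum_i `|x i|.
Proof.
rewrite -(@ler_pXn2r _ 2) ?nnegrE ?sumr_ge0// normr_dsum sqrtCK.
suff [] : 0 <= \sum_i `|x i| /\
  \sum_i `|x i| ^+ 2 <= (\sum_i `|x i|) ^+ 2 by [].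
apply: (big_ind2 (fun b a : R[i] => 0 <= b /\ a <= b ^+ 2)).
- by rewrite expr0n.
- move=> b a d c [b0 ab] [d0 cd]; split; first exact: addr_ge0.
  rewrite sqrrD addrAC (le_trans (lerD ab cd))// lerDl.
  by rewrite mulrn_wge0// mulr_ge0.
- by move=> i _.
Qed.

Lemma dsum_complete (F : set_system V) : ProperFilter F -> cauchy F -> cvg F.
Proof.
move=> FF /cauchyP Fc.
have ball_comp i (x y : V) e : ball x e y -> ball (x i) e (y i).
  rewrite -!ball_normE /= => xy; apply: le_lt_trans xy.
  by have := dsum_norm_comp (x - y) i; rewrite !ffunE.
have cF i : cvg ((fun x : V => x i) @ F).
  apply: cauchy_cvg; apply/cauchy_exP => e e0.
  have [x Fx] := Fc e e0; exists (x i).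
  exact: (@filterS _ F _ _ _ (fun y => ball_comp i x y e) Fx).
apply/cvg_ex; exists ([ffun i => lim ((fun x : V => x i) @ F)] : V).
apply/cvgrPdist_lt => e e0.
have e'0 : 0 < e / n.+1%:R by rewrite divr_gt0.
near=> x; apply: le_lt_trans (dsum_norm_le_sum _) _.
apply: (@le_lt_trans _ _ (\sum_(i < n) e / n.+1%:R)).
  apply: ler_sum => i _; rewrite !ffunE ltW//; move: i; near: x.
  by apply: filter_forall => i; apply: cvgr_dist_lt.
rewrite sumr_const card_ord -[ltLHS]mulr_natr mulrAC.
by rewrite ltr_pdivrMr ?ltr_pM2l ?ltr_nat.
Unshelve. all: by end_near. Qed.

HB.instance Definition _ := Uniform_isComplete.Build V dsum_complete.

HB.instance Definition _ := NormedModule_hasInner.Build R V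
  (fun x : V => erefl `|x|).

End DirectSum.

(* By linear_boundedP, this says `|S x| <= M * `|x| for some M and all x. *)
Definition bounded_operator (R : realType) (K : hilbertType R)
    (S : {linear K -> K}) : Prop := bounded_near S (nbhs 0).

(* The action of the operator matrix (M i j) on the direct sum. *)
Definition opmx (R : realType) (n : nat) (H : hilbertType R)
    (M : 'M[{linear H -> H}]_n) (x : dsum n H) : dsum n H :=
  [ffun i => \sum_j M i j (x j)].

Section OpmxLinear.
Variables (R : realType) (n : nat) (H : hilbertType R).
Variable M : 'M[{linear H -> H}]_n.

Lemma opmx_linear : linear (opmx M).
Proof.
move=> a x y; apply/ffunP => i; rewrite !ffunE scaler_sumr -big_split.
by apply: eq_bigr => j _; rewrite !ffunE linearP.
Qed.

HB.instance Definition _ := GRing.isLinear.Build R[i] (dsum n H) (dsum n H) _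
  (opmx M) opmx_linear.

Lemma opmx_bounded : (forall i j, bounded_operator (M i j)) ->
  bounded_operator (opmx M).
Proof.
move=> Mb; have [r r0 rM] : exists2 r : R[i], 0 < r &
    forall i j x, `|M i j x| <= r * `|x|.
  have Mr : \forall r \near +oo, forall i j x, `|M i j x| <= r * `|x|.
    apply: (@filter_forall R[i] _ (fun i r =>
      forall j x, `|M i j x| <= r * `|x|)) => i.
    apply: (@filter_forall R[i] _ (fun j r =>
      forall x, `|M i j x| <= r * `|x|)) => j.
    exact/linear_boundedP/Mb.
  have /pinfty_ex_gt0[r r0 rM] := Mr; by exists r.
apply/ex_bound; exists (\sum_(i < n) \sum_(j < n) r).
apply/(@nbhs_norm0P R[i] (dsum n H)); exists 1 => //= x /= /ltW x1.
apply: le_trans (dsum_norm_le_sum _) _; apply: ler_sum => i _; rewrite ffunE.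
apply: le_trans (ler_norm_sum _ _ _) _; apply: ler_sum => j _.
apply: le_trans (rM i j _) _; apply: ler_piMr; first exact: ltW.
exact: le_trans (dsum_norm_comp x j) x1.
Qed.

End OpmxLinear.

(* With indices starting at 0, rev_ord i is the index n - i - 1, that is, row i
   and column n - i + 1 when indices start at 1. *)
Definition antidiag_opmx (R : realType) (n : nat) (H : hilbertType R)
    (A : 'I_n -> {linear H -> H}) : 'M[{linear H -> H}]_n :=
  \matrix_(i, j) if j == rev_ord i then A i else \0.

(* The set below is bounded when S is a bounded operator, so sup is a genuine
   supremum as soon as K != 0; on K = 0 it is sup set0 = 0. *)
Definition numrad (R : realType) (K : hilbertType R) (S : K -> K) : R :=
  sup [set Normc.normc (inner (S x) x) | x in [set x : K | `|x| = 1]].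

Lemma normr_normc (R : realType) (z : R[i]) : `|z| = (Normc.normc z)%:C.
Proof. by case: z => a b; rewrite normc_def. Qed.

Lemma numrad_has_ubound (R : realType) (K : hilbertType R)
    (S : {linear K -> K}) : bounded_operator S ->
  has_ubound [set Normc.normc (inner (S x) x) | x in [set x : K | `|x| = 1]].
Proof.
move=> /linear_boundedP/pinfty_ex_gt0[M M0 SM].
exists (complex.Re M) => _ [x /= x1 <-].
suff : (Normc.normc (inner (S x) x))%:C <= M by rewrite lecE => /andP[].
rewrite -normr_normc (le_trans (dot_cauchy_schwarz _ _ _))//.
by rewrite -!normr_inner x1 mulr1 (le_trans (SM x))// x1 mulr1.
Qed.

(* Main.v *)
Require Import Defs.
From HB Require Import structures.
From mathcomp Require Import all_boot all_order all_algebra.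
From mathcomp Require Import sesquilinear complex.
From mathcomp Require Import boolp classical_sets reals topology normedtype.
From mathcomp Require Import ring.
Import Order.TTheory GRing.Theory Num.Theory.
Import numFieldNormedType.Exports.
Local Open Scope ring_scope.

(* The square of T is block diagonal with blocks A_i A_(n-i+1), so each
   w(A_i A_(n-i+1)) is at most w(T ^ 2), hence at most w(T) ^ 2 by the power
   inequality; the triangle inequality then bounds w(A_i A_(n-i+1) +-
   A_(n-i+1) A_i) by 2 w(T) ^ 2. *)

(* With [y = W x + z T x] and [y' = W x - z T x], where [z ^ 2 <T T x, x>] is
   the modulus of [<T T x, x>], factoring [W ^ 2 - (z T) ^ 2] gives
   [<(W - z T) y, y> + <(W + z T) y', y'> = 2 W (W ^ 2 <x, x> - |<T T x, x>|)],
   and both terms on the left have nonnegative real part. *)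
Lemma quadratic_form_sqr_le (C : numClosedFieldType) (U : lmodType C)
    (f : {dot U for @Num.conj C}) (T : {linear U -> U}) (W : C) :
  0 < W -> (forall x, `|f (T x) x| <= W * f x x) ->
  forall x, `|f (T (T x)) x| <= W ^+ 2 * f x x.
Proof.
move=> W0 TW x.
have WC : Num.conj W = W by apply/CrealP; exact: gtr0_real.
have [->|c0] := eqVneq (f (T (T x)) x) 0.
  by rewrite normr0 mulr_ge0 ?exprn_ge0 ?dnorm_ge0 ?ltW.
set c := f (T (T x)) x in c0 *.
pose z := sqrtC (`|c| / c).
have z2 : z ^+ 2 * c = `|c| by rewrite sqrtCK divfK.
have z1 : `|z| = 1.
  apply/eqP; rewrite -(@pexpr_eq1 _ _ 2)// -normrX sqrtCK normrM normrV ?unitfE//.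
  by rewrite normr_id divff ?normr_eq0.
pose y := W *: x + z *: T x; pose y' := W *: x - z *: T x.
have key : W * f y y + W * f y' y' - (z * f (T y) y - z * f (T y') y')
    = 2 * W * (W ^+ 2 * f x x - `|c|).
  have -> : T y = W *: T x + z *: T (T x) by rewrite linearD !linearZ.
  have -> : T y' = W *: T x - z *: T (T x) by rewrite linearB !linearZ.
  rewrite -z2 /c !(linearDl, linearNl, linearZl_LR) /=.
  rewrite !(linearDr, linearNr, linearZr_LR) /= WC.
  by ring.
have yb v : `|z * f (T v) v| <= W * f v v by rewrite normrM z1 mul1r.
have a0 v : W * f v v \is Num.real by rewrite ger0_real// mulr_ge0 ?dnorm_ge0 ?ltW.
rewrite -subr_ge0 -(@pmulr_rge0 _ (2 * W)) ?mulr_gt0// -key subr_ge0.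
apply: le_trans _ (le_trans (ler_normB _ _) (lerD (yb y) (yb y'))).
(* In [C] a number lies below its modulus only when it is real; [key] exhibits this difference as a
   combination of real numbers. *)
apply: real_ler_norm.
have -> : z * f (T y) y - z * f (T y') y' =
    W * f y y + W * f y' y' - 2 * W * (W ^+ 2 * f x x - `|c|).
  by rewrite -key; ring.
have fr : f x x \is Num.real by rewrite ger0_real ?dnorm_ge0.
have Wr : W \is Num.real by exact: gtr0_real.
apply: rpredB; first exact: rpredD.
by do !apply: rpredM; rewrite ?rpredB ?rpredM ?rpredX ?normr_real ?realn.
Qed.

Section NumericalRadius.
Variables (R : realType) (K : hilbertType R).
Local Open Scope complex_scope.

Lemma numrad_le (S : K -> K) (c : R) : 0 <= c ->
  (forall x, `|inner (S x) x| <= c%:C * inner x x) -> numrad S <= c.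
Proof.
move=> c0 Sc; rewrite /numrad.
set X := (X in sup X).
(* With no unit vector in [K] the supremum is [sup set0 = 0]; this case rests on [0 <= c]. *)
have [->|/set0P X0] := eqVneq X set0; first by rewrite sup0.
apply: ge_sup => // _ [x /= x1 <-].
have := Sc x; rewrite normr_normc -[inner x x]sqrtCK -normr_inner x1 expr1n mulr1.
by rewrite lecR.
Qed.

Lemma numrad_ge0 (S : K -> K) : 0 <= numrad S.
Proof.
rewrite /numrad; set X := (X in sup X).
(* [S] is arbitrary here, so the set may be empty or unbounded; [sup] then has the default value
   0. *)
have [supX|] := pselect (has_sup X); last by move=> /sup_out ->.
case: supX => -[r Xr] ubX; apply: (@le_trans _ _ r); last exact: ub_le_sup.
by case: Xr => x _ <-; rewrite -lecR -normr_normc; exact: normr_ge0.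
Qed.

(** Both sides scale by the square of the norm of [x], which reduces the bound to a unit vector. *)
Lemma quadratic_form_le_numrad (S : {linear K -> K}) (x : K) :
  bounded_operator S -> `|inner (S x) x| <= (numrad S)%:C * inner x x.
Proof.
move=> Sb; have [->|x0] := eqVneq x 0.
  by rewrite linear0r normr0 linear0r mulr0.
have nx0 : 0 < `|x| by rewrite normr_gt0.
pose u := `|x|^-1 *: x.
have u1 : `|u| = 1 by rewrite normrZ normfV normr_id mulVf ?gt_eqF.
have xu : x = `|x| *: u by rewrite scalerA divff ?gt_eqF// scale1r.
have le : `|inner (S u) u| <= (numrad S)%:C.
  rewrite normr_normc lecR; apply: ub_le_sup; last by exists u.
  exact: numrad_has_ubound.
have xx : inner x x = `|x| ^+ 2 by rewrite normr_inner sqrtCK.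
have -> : inner (S x) x = `|x| * (Num.conj `|x| * inner (S u) u).
  by rewrite [in LHS]xu [X in inner X _]linearZ linearZl_LR linearZr_LR.
rewrite xx !normrM norm_conjC normr_id mulrA -expr2 mulrC.
by rewrite ler_pM2r ?exprn_gt0.
Qed.

End NumericalRadius.

Section Antidiagonal.
Variables (R : realType) (H : hilbertType R) (n : nat).
Variable A : 'I_n -> {linear H -> H}.
Local Open Scope complex_scope.

Lemma antidiag_opmxE (x : dsum n H) i :
  opmx (antidiag_opmx A) x i = A i (x (rev_ord i)).
Proof.
rewrite ffunE (bigD1 (rev_ord i))//= mxE eqxx big1 ?addr0// => j ji.
by rewrite mxE (negbTE ji).
Qed.

Lemma antidiag_opmx_bounded : (forall i, bounded_operator (A i)) ->
  bounded_operator (opmx (antidiag_opmx A)).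
Proof.
move=> Ab; apply: opmx_bounded => i j; rewrite mxE.
case: ifP => _; first exact: Ab.
by apply/linear_boundedP; near=> r => x; rewrite normr0 mulr_ge0.
Unshelve. all: by end_near. Qed.

(** The strict bound makes [W] positive even if the numerical radius is 0, as
    [quadratic_form_sqr_le] requires. *)
Lemma antidiag_prod_form_le (W : R) : (forall i, bounded_operator (A i)) ->
  numrad (opmx (antidiag_opmx A)) < W ->
  forall i (u : H),
    `|inner (A i (A (rev_ord i) u)) u| <= (W ^+ 2)%:C * inner u u.
Proof.
move=> Ab TW i u.
have W0 : 0 < W by apply: le_lt_trans TW; exact: numrad_ge0.
pose T : {linear dsum n H -> dsum n H} := opmx (antidiag_opmx A).
(* Supported on the single coordinate [i], this vector isolates the [i]-th diagonal block of the
   square of [T]. *)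
pose x : dsum n H := [ffun j => if j == i then u else 0].
have innerx v : inner v x = inner (v i) u.
  rewrite [LHS](bigD1 i)//= ffunE eqxx big1 ?addr0// => j ji.
  by rewrite ffunE (negbTE ji) linear0r.
have := @quadratic_form_sqr_le _ _ inner T W%:C _ _ x.
rewrite !innerx !antidiag_opmxE rev_ordK !ffunE eqxx rmorphXn; apply.
  by rewrite ltcR.
move=> v; apply: le_trans (quadratic_form_le_numrad _ _ _ _ _) _.
  exact: antidiag_opmx_bounded.
by rewrite ler_wpM2r ?dnorm_ge0// lecR ltW.
Qed.

End Antidiagonal.

Theorem theorem4p1 (R : realType) (H : hilbertType R) (n : nat)
    (n_gt0 : (0 < n)%N) (A : 'I_n -> {linear H -> H})
    (A_bounded : forall i, bounded_operator (A i)) :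
  numrad (opmx (antidiag_opmx A)) >=
  (Num.sqrt 2)^-1 *
  \big[Num.max/0]_(i < n)
    Num.max
      (Num.sqrt (numrad ((A i \o A (rev_ord i)) \+ (A (rev_ord i) \o A i))))
      (Num.sqrt (numrad ((A i \o A (rev_ord i)) \- (A (rev_ord i) \o A i)))).
Proof.
set w := numrad (opmx _).
have s20 : 0 < Num.sqrt 2 :> R by rewrite sqrtr_gt0.
(* The slack [e] supplies a bound strictly above [w]. *)
apply/ler_addgt0Pr => e e0.
have wW : w < w + e by rewrite ltrDl.
have W0 : 0 <= w + e by rewrite addr_ge0 ?numrad_ge0 ?ltW.
rewrite ler_pdivrMl//.
have sqrt_le c : c <= 2 * (w + e) ^+ 2 -> Num.sqrt c <= Num.sqrt 2 * (w + e).
  by move=> /ler_wsqrtr; rewrite sqrtrM// sqrtr_sqr ger0_norm.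
have c0 : 0 <= 2 * (w + e) ^+ 2 by rewrite mulr_ge0 ?exprn_ge0.
apply: bigmax_le => [|i _]; first by rewrite mulr_ge0 ?(ltW s20).
(* Since [rev_ord] is an involution, the blocks at [i] and [rev_ord i] are the two products in
   opposite orders. Each form is bounded with constant [(w + e) ^+ 2], so their sum and difference
   get twice that, whence the factor [Num.sqrt 2]. *)
have le1 := @antidiag_prod_form_le _ _ _ _ _ A_bounded wW i.
have le2 := @antidiag_prod_form_le _ _ _ _ _ A_bounded wW (rev_ord i).
rewrite rev_ordK in le2.
rewrite ge_max; apply/andP; split; apply/sqrt_le/numrad_le => // x /=.
  rewrite linearDl (le_trans (ler_normD _ _))// rmorphM rmorph_nat /=.
  by rewrite mulr_natl mulr2n mulrDl lerD ?le1 ?le2.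
rewrite linearBl (le_trans (ler_normB _ _))// rmorphM rmorph_nat /=.
by rewrite mulr_natl mulr2n mulrDl lerD ?le1 ?le2.
Qed.
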